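(* A finitely consistent SDFS $F\subseteq\mathcal Q(\mathcal T)$ is finitely coherent if and only if $F=\bigcap\{F'\in\overline{\mathbf F}_{\mathrm{fin,c}}:F\subseteq F'\}$, where $\overline{\mathbf F}_{\mathrm{fin,c}}$ is the set of all complete and finitely coherent SDFSes.
   Context: Let $\mathcal T$ be a non-empty set (of ''things''), $\mathrm{cl}:\mathcal P(\mathcal T)\to\mathcal P(\mathcal T)$ a closure operator (extensive, monotone, idempotent), $\mathcal T_-\subseteq\mathcal T$ a set of forbidden things, $\mathcal T_+:=\mathrm{cl}(\emptyset)$, with standing assumption $\mathcal T_+\cap\mathcal T_-=\emptyset$. $\mathcal Q(\mathcal T)$ is the set of finite subsets of $\mathcal T$ (including $\emptyset$). For $\mathcal V\subseteq\mathcal Q(\mathcal T)$, $\Sigma_{\mathcal V}$ is the set of maps $\sigma:\mathcal V\to\mathcal T$ with $\sigma(A)\in A$ for all $A\in\mathcal V$, and $\sigma(\mathcal V):=\{\sigma(A):A\in\mathcal V\}$. An SDFS is any $F\subseteq\mathcal Q(\mathcal T)$. It is finitely coherent if (F1) $\emptyset\notin F$; (F2) if $A_1\in F$ and $A_1\subseteq A_2\in\mathcal Q(\mathcal T)$ then $A_2\in F$; (F3) if $A\in F$ then $A\setminus\mathcal T_-\in F$; (F4) $\{t\}\in F$ for all $t\in\mathcal T_+$; (F5) for every non-empty finite $\mathcal V\subseteq F$ and every family $(t_\sigma)_{\sigma\in\Sigma_{\mathcal V}}$ with $t_\sigma\in\mathrm{cl}(\sigma(\mathcal V))$, $\{t_\sigma:\sigma\in\Sigma_{\mathcal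 V}\}\in F$. An SDFS is finitely consistent if it is included in some finitely coherent SDFS. An SDFS $F$ is complete if for all finite $A_1,A_2\subseteq\mathcal T$, $A_1\cup A_2\in F$ implies $A_1\in F$ or $A_2\in F$. *)

(* Defs.v *)
From mathcomp Require Import all_boot.
From mathcomp Require Import boolp classical_sets functions cardinality.

Set Implicit Arguments.
Unset Strict Implicit.
Unset Printing Implicit Defensive.

Local Open Scope classical_set_scope.

Section Defs.
Variable T : Type.

Record closure_operator (cl : set T -> set T) : Prop := ClosureOperator {
  cl_extensive : forall A, A `<=` cl A;
  cl_monotone : forall A B, A `<=` B -> cl A `<=` cl B;
  cl_idempotent : forall A, cl (cl A) = cl A }.

Definition finite_subsets : set (set T) := [set A | finite_set A].

(* The coercion [set_type] turns [V] into the subtype of its members, so a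
   selection is a map defined on [V] only. *)
Definition selections (V : set (set T)) : set (V -> T) :=
  [set s | forall A : V, val A (s A)].

Definition sdfs (F : set (set T)) : Prop := F `<=` finite_subsets.

Variables (cl : set T -> set T) (Tminus : set T).

Definition Tplus : set T := cl set0.

(* In [F5], [range s] is the set of things selected by [s].  The family [t] is
   total on [V -> T], but only its values on [selections V] are constrained or
   used. *)
Record finitely_coherent (F : set (set T)) : Prop := FinitelyCoherent {
  F_sdfs : sdfs F;
  F1 : ~ F set0;
  F2 : forall A1 A2, F A1 -> A1 `<=` A2 -> finite_subsets A2 -> F A2;
  F3 : forall A, F A -> F (A `\` Tminus);
  F4 : forall t, Tplus t -> F [set t];
  F5 : forall V : set (set T), V !=set0 -> finite_set V -> V `<=` F ->
       forall t : (V -> T) -> T,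
         (forall s, selections s -> cl (range s) (t s)) ->
         F (t @` @selections V) }.

Definition finitely_consistent (F : set (set T)) : Prop :=
  sdfs F /\ exists2 F', finitely_coherent F' & F `<=` F'.

Definition complete (F : set (set T)) : Prop :=
  forall A1 A2, finite_set A1 -> finite_set A2 ->
    F (A1 `|` A2) -> F A1 \/ F A2.

Definition complete_finitely_coherent : set (set (set T)) :=
  [set F | complete F /\ finitely_coherent F].

End Defs.

(* Main.v *)
(** A set [D] that is closed under [cl] of its finite subsets and avoids
    [Tminus] yields a complete finitely coherent SDFS: the finite sets that
    meet [D].  So if [F] is finitely coherent and [A] is a finite set outside
    [F], it suffices to find such a [D] that meets every member of [F] and
    avoids [A].  By F5, F3 and F2, every finite [V] included in [F] has a
    selection whose closure avoids [A `|` Tminus]; since the members of [F] are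
    finite, Zorn's lemma glues these selections together. *)
Require Import Defs.
From mathcomp Require Import all_boot.
From mathcomp Require Import boolp classical_sets functions cardinality.

Set Implicit Arguments.
Unset Strict Implicit.
Unset Printing Implicit Defensive.

Local Open Scope classical_set_scope.

Lemma finite_set_ind (T : Type) (P : set T -> Prop) :
  P set0 -> (forall x A, finite_set A -> P A -> P (x |` A)) ->
  forall A, finite_set A -> P A.
Proof.
elim/Pchoice: T => T in P *; move=> P0 PU A /finite_seqP[s ->].
elim: s => [|x s IHs]; first by rewrite set_nil.
rewrite (_ : [set` x :: s] = x |` [set` s]); first exact: PU.
by apply/seteqP; split=> y; rewrite /= inE => /predU1P.
Qed.

Lemma finite_subset_chain (T : Type) (C : set (set T)) (X : set T) :
  total_on C subset -> C !=set0 -> finite_set X ->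
  X `<=` \bigcup_(c in C) c -> exists2 c, C c & X `<=` c.
Proof.
move=> totC [c0 Cc0] finX; move: X finX; apply: finite_set_ind.
  by move=> _; exists c0.
move=> x X _ IHX xXC.
have [c Cc Xc] : exists2 c, C c & X `<=` c.
  by apply: IHX => y Xy; apply: xXC; right.
have [d Cd dx] : (\bigcup_(c in C) c) x by apply: xXC; left.
case: (totC c d Cc Cd) => [cd|dc].
  by exists d => // y [->//|/Xc /cd].
by exists c => // y [->|/Xc//]; apply: dc.
Qed.

(** Fixing the value [t0] off [D] is what leaves only finitely many total functions; adding a point
    to [D] adds one coordinate. *)
Lemma finite_set_funs (I T : Type) (t0 : T) (A : I -> set T) (D : set I) :
  finite_set D -> (forall i, D i -> finite_set (A i)) ->
  finite_set [set f : I -> T | (forall i, D i -> A i (f i)) /\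
                               (forall i, ~ D i -> f i = t0)].
Proof.
move=> finD; move: D finD; apply: finite_set_ind => [_|x D finD IHD finA].
  apply: (@sub_finite_set _ _ [set (fun=> t0)]); last exact: finite_set1.
  by move=> f [_ f0]; apply/funext => i; apply: f0.
have [Dx|nDx] := pselect (D x).
  have xD : x |` D = D by apply/seteqP; split=> [i [->//|//]|i Di]; right.
  by rewrite xD in finA *; exact: IHD.
pose upd (f : I -> T) (y : T) i := if `[< i = x >] then y else f i.
have finDA : forall i, D i -> finite_set (A i) by move=> i Di; apply: finA; right.
apply: sub_finite_set (finite_image2 upd (IHD finDA) (finA x (or_introl erefl))).
(* Resetting [f] to the default at [x] gives a function counted by the induction hypothesis. *)
move=> f [fA f0]; exists (upd f t0).
  split=> i Di; rewrite /upd; case: asboolP => ix //.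
  - by move: Di; rewrite ix.
  - by apply: fA; right.
  - by apply: f0 => -[].
exists (f x); first by apply: fA; left.
by apply/funext => i; rewrite /upd; case: asboolP => // ->.
Qed.

Section Selections.
Context {T : Type} (t0 : T).
Implicit Types (V : set (set T)).

(** Total functions on [set T] can be reused for different [V], which maps on the subtypes cannot;
    the gluing below relies on this. *)
Definition extend {V} (s : V -> T) (A : set T) : T :=
  match pselect (A \in V) with left VA => s (exist _ A VA) | right _ => t0 end.

Lemma extendE V (s : V -> T) (A : V) : extend s (val A) = s A.
Proof.
rewrite /extend; case: pselect => [VA|/(_ (valP A))//].
by congr s; apply: val_inj.
Qed.

Lemma image_extend V (s : V -> T) : extend s @` V = range s.
Proof.
apply/seteqP; split=> t.
  move=> [A VA <-]; exists (exist _ A (mem_set VA)) => //.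
  by rewrite -[LHS]extendE.
by move=> [A _ <-]; exists (val A); [exact: set_mem (valP A)|exact: extendE].
Qed.

Lemma finite_selections V : finite_set V -> (forall A, V A -> finite_set A) ->
  finite_set (@selections T V).
Proof.
move=> finV finA.
apply: sub_finite_set (finite_image (fun f (A : V) => f (val A))
  (@finite_set_funs _ _ t0 id V finV finA)).
move=> s sV; exists (extend s); last by apply/funext => A; exact: extendE.
split=> A VA.
  by have := sV (exist _ A (mem_set VA)); rewrite -extendE.
by rewrite /extend; case: pselect => // VA'; case: (VA (set_mem VA')).
Qed.

End Selections.

Definition hitting {T : Type} (D : set T) : set (set T) :=
  [set B | finite_set B /\ B `&` D !=set0].

Lemma hitting_complete (T : Type) (D : set T) : complete (hitting D).
Proof.
move=> A1 A2 fin1 fin2 [_ [t [[At|At] Dt]]]; [left|right];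
  by split=> //; exists t.
Qed.

Section ClosureOperator.
Context {T : Type} {cl : set T -> set T} (clP : closure_operator cl).
Context (Tminus : set T).

Let cl_ext : forall A, A `<=` cl A := cl_extensive clP.
Let cl_mono A B : A `<=` B -> cl A `<=` cl B := @cl_monotone _ _ clP A B.

(** F4 is the closure hypothesis for the empty set. For F5, some selection takes all its values in
    [D], and the hypothesis for its finite range puts its [t]-value in [D]. *)
Lemma hitting_coherent (t0 : T) (D : set T) :
  (forall X, finite_set X -> X `<=` D -> cl X `<=` D) ->
  D `<=` ~` Tminus -> finitely_coherent cl Tminus (hitting D).
Proof.
move=> Dcl DTm; split.
- by move=> A [].
- by case=> _ [t []].
- by move=> A1 A2 [_ [t [A1t Dt]]] A12 fin2; split=> //; exists t; split=> //;
    apply: A12.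
- move=> A [finA [t [At Dt]]]; split; first exact: finite_setD.
  by exists t; split=> //; split=> //; apply: DTm.
- move=> t Tt; split; first exact: finite_set1.
  by exists t; split=> //; apply: (Dcl set0).
move=> V _ finV VD t tcl.
have finA A : V A -> finite_set A by move=> /VD[].
split; first exact/finite_image/(finite_selections t0).
have [s sP] : {s : V -> T & forall A : V, val A (s A) /\ D (s A)}.
  apply: (@choice V T (fun A x => val A x /\ D x)) => A.
  by have [_ [x [Ax Dx]]] := VD _ (set_mem (valP A)); exists x.
have selS : selections s by move=> A; case: (sP A).
exists (t s); split; first by exists s.
apply: (Dcl (range s)); last exact: tcl.
- rewrite -(image_extend t0); exact: finite_image.
- by move=> _ [A _ <-]; case: (sP A).
Qed.

Lemma coherent_selection (t0 : T) (F : set (set T)) (A : set T)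
    (V : set (set T)) :
  Tplus cl `&` Tminus = set0 -> finitely_coherent cl Tminus F ->
  finite_set A -> ~ F A -> finite_set V -> V `<=` F ->
  exists s : set T -> T, (forall B, V B -> B (s B)) /\
    cl (s @` V) `<=` ~` (A `|` Tminus).
Proof.
move=> TpTm cohF finA nFA finV VF.
(* F5 says nothing about an empty [V]; there the closure is [Tplus], which misses [A] by F4 and
   F2. *)
have [V0|/set0P V0] := eqVneq V set0.
  exists (fun=> t0); rewrite V0 image_set0; split=> // t Tt [At|Tmt].
    by apply/nFA/(F2 cohF (F4 cohF Tt)) => // _ ->.
  by suff : set0 t by []; rewrite -TpTm.
apply: contrapT => noS; apply: nFA.
(* If all closures meet the forbidden union, F5 puts a set of such bad points in [F]; F3 strips off
   [Tminus] and F2 enlarges the rest to [A]. *)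
have [t tP] : {t : (V -> T) -> T & forall s, selections s ->
    cl (range s) (t s) /\ (A `|` Tminus) (t s)}.
  apply: (@choice (V -> T) T (fun s x => selections s ->
    cl (range s) x /\ (A `|` Tminus) x)) => s.
  have [sV|nsV] := pselect (selections s); last by exists t0.
  apply: contrapT => noX; apply: noS; exists (extend t0 s); split.
    by move=> B VB; have := sV (exist _ B (mem_set VB)); rewrite -(extendE t0).
  by rewrite image_extend => x clx Nx; apply: noX; exists x.
have tcl s : selections s -> cl (range s) (t s) by case/tP.
apply: (F2 cohF (F3 cohF (F5 cohF V0 finV VF tcl))) => //.
by move=> _ [[s /tP[_ At] <-] nTmt]; case: At.
Qed.

Lemma compact_selection (F : set (set T)) (N : set T) :
  F `<=` @finite_subsets T ->
  (forall V, finite_set V -> V `<=` F ->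
    exists s : set T -> T, (forall B, V B -> B (s B)) /\ cl (s @` V) `<=` ~` N) ->
  exists D : set T, (forall B, F B -> B `&` D !=set0) /\
    (forall X, finite_set X -> X `<=` D -> cl X `<=` ~` N).
Proof.
move=> finF selF.
(* Compatibility of finite parts of [D] with selections on finite parts of [F] has finite character,
   hence passes to unions of chains; an empty [V] gives the second conclusion. *)
pose P D := forall V X, finite_set V -> V `<=` F -> finite_set X -> X `<=` D ->
  exists s : set T -> T, (forall B, V B -> B (s B)) /\
    cl (s @` V `|` X) `<=` ~` N.
have [C CP totC|D [PD maxD]] := @Zorn_bigcup T P.
  move=> V X finV VF finX XC.
  have [C0|/set0P C0] := eqVneq C set0.
    have -> : X = set0 by apply/seteqP; split=> // x /XC; rewrite C0 => -[].
    by have [s] := selF V finV VF; exists s; rewrite setU0.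
  by have [c Cc Xc] := finite_subset_chain totC C0 finX XC; exact: (CP c).
exists D; split; last first.
  move=> X finX XD.
  have [s [_]] := PD set0 X (finite_set0 _) (@sub0set _ _) finX XD.
  by rewrite image_set0 set0U.
(* Otherwise, by maximality, each [b] in [B] has a finite obstruction
   [W b].1, [W b].2 to adding [b] to [D]; a selection for all of these together
   with [B] itself selects some [b] in [B], contradicting the obstruction for
   that [b]. *)
move=> B FB; apply: contrapT => BD.
have obstr b : exists W : set (set T) * set T, B b ->
    [/\ finite_set W.1, W.1 `<=` F, finite_set W.2, W.2 `<=` D &
      ~ exists s : set T -> T, (forall A, W.1 A -> A (s A)) /\
        cl (s @` W.1 `|` (b |` W.2)) `<=` ~` N].
  have [Bb|nBb] := pselect (B b); last by exists (set0, set0).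
  apply: contrapT => noW; apply: (maxD (b |` D)).
    split=> [|DbD]; first exact: subsetUr.
    by apply: BD; exists b; split=> //; apply: DbD; left.
  move=> V X finV VF finX XD; apply: contrapT => noS.
  (* Taking [b] out of [X] leaves a subset of [D]; the obstruction puts [b] back. *)
  apply: noW; exists (V, X `\ b) => _; split=> //.
  - exact: finite_setD.
  - by move=> x [/XD[//|]].
  move=> [s [sV clN]]; apply: noS; exists s; split=> //.
  apply: subset_trans clN; apply: cl_mono => x [|Xx]; first by left.
  by right; have [->|nxb] := pselect (x = b); [left|right].
have [W WP] := @choice _ _ _ obstr.
have finB : finite_set B by exact: finF.
have [||||s [sV clN]] := PD (B |` \bigcup_(b in B) (W b).1)
    (\bigcup_(b in B) (W b).2).
- rewrite finite_setU; split; first exact: finite_set1.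
  by apply: bigcup_finite => // b /WP[].
- by move=> A [->//|[b /WP[_ + _ _ _]]]; apply.
- by apply: bigcup_finite => // b /WP[].
- by move=> x [b /WP[_ _ _ + _]]; apply.
have Bb : B (s B) by apply: sV; left.
have [_ _ _ _] := WP _ Bb; apply; exists s; split.
  by move=> A WA; apply: sV; right; exists (s B).
apply: subset_trans clN; apply: cl_mono => x [[A WA <-]|[->|Wx]].
- by left; exists A => //; right; exists (s B).
- by left; exists B => //; left.
- by right; exists (s B).
Qed.

(** Since [cl] is not assumed finitary, [cl D] may contain points outside the closures of finite
    subsets of [D], and only the latter are controlled. *)
Definition finitary_closure (D : set T) : set T :=
  \bigcup_(X in [set X | finite_set X /\ X `<=` D]) cl X.

Lemma finitary_closureP (D X : set T) : finite_set X ->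
  X `<=` finitary_closure D -> cl X `<=` finitary_closure D.
Proof.
move=> finX XD.
have Yex x : exists Y, X x -> [/\ finite_set Y, Y `<=` D & cl Y x].
  have [/XD[Y [finY YD] clY]|nXx] := pselect (X x); last by exists set0.
  by exists Y.
have [Y YP] := @choice _ _ _ Yex.
(* One finite subset of [D] whose closure contains all of [X]; idempotence then gives [cl X] too. *)
pose U := \bigcup_(x in X) Y x.
move=> t clt; exists U.
  split; first by apply: bigcup_finite => // x /YP[].
  by move=> y [x /YP[_ + _]]; apply.
rewrite -(cl_idempotent clP); apply: cl_mono clt => x Xx.
have [_ _ clY] := YP _ Xx; apply: cl_mono clY; exact: bigcup_sup.
Qed.

Lemma complete_separation (t0 : T) (F : set (set T)) (A : set T) :
  Tplus cl `&` Tminus = set0 -> finitely_coherent cl Tminus F ->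
  finite_set A -> ~ F A ->
  exists F', [/\ complete_finitely_coherent cl Tminus F', F `<=` F' & ~ F' A].
Proof.
move=> TpTm cohF finA nFA.
have [D [FD DN]] := compact_selection (F_sdfs cohF)
  (fun V => @coherent_selection t0 F A V TpTm cohF finA nFA).
have clDN : finitary_closure D `<=` ~` (A `|` Tminus).
  by move=> t [X [finX XD]]; exact: DN.
exists (hitting (finitary_closure D)); split.
- split; first exact: hitting_complete.
  apply: (hitting_coherent t0); first exact: finitary_closureP.
  by move=> t /clDN + Tt; apply; right.
- move=> B FB; split; first exact: (F_sdfs cohF).
  have [t [Bt Dt]] := FD B FB; exists t; split=> //.
  exists [set t]; last exact: cl_ext.
  by split; [exact: finite_set1|move=> _ ->].
- by move=> [_ [t [At /clDN]]]; apply; left.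
Qed.

End ClosureOperator.

Unset Implicit Arguments.

Theorem theorem13 (T : Type) (T_nonempty : [set: T] !=set0)
    (cl : set T -> set T) (cl_closure : closure_operator cl)
    (Tminus : set T) (Tplus_Tminus : Tplus cl `&` Tminus = set0)
    (F : set (set T)) (F_consistent : finitely_consistent cl Tminus F) :
  finitely_coherent cl Tminus F <->
  F = \bigcap_(F' in [set F' | complete_finitely_coherent cl Tminus F' /\
                               F `<=` F']) F'.
Proof.
have [t0 _] := T_nonempty; split=> [cohF|FE].
  apply/seteqP; split=> [A FA F' [_ FF']|A AF]; first exact: FF'.
  have sep B := @complete_separation _ _ cl_closure Tminus t0 F B
    Tplus_Tminus cohF.
  (* Separating from the empty set shows that the intersected family is not empty, so members of the
     intersection are finite. *)
  have [F0 [cohF0 FF0 _]] := sep set0 (finite_set0 _) (F1 cohF).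
  have finA : finite_set A.
    exact: (F_sdfs (proj2 cohF0) (AF F0 (conj cohF0 FF0))).
  apply: contrapT => /(sep A finA)[F' [cohF' FF' nF'A]].
  exact: (nF'A (AF F' (conj cohF' FF'))).
(* Finiteness and F1 come from consistency, as the family might be empty here; F2 to F5 pass to
   intersections. *)
have [sdfsF [G cohG FG]] := F_consistent.
split=> //.
- by move=> /FG; exact: (F1 cohG).
- move=> A1 A2 FA1 A12 finA2; rewrite FE => F' [[cF' cohF'] FF'].
  by apply: (F2 cohF') A12 finA2; exact: FF'.
- move=> A FA; rewrite FE => F' [[cF' cohF'] FF'].
  by apply: (F3 cohF'); exact: FF'.
- by move=> t Tt; rewrite FE => F' [[cF' cohF'] FF']; exact: (F4 cohF').
- move=> V V0 finV VF t tcl; rewrite FE => F' [[cF' cohF'] FF'].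
  by apply: (F5 cohF') => //; exact: subset_trans FF'.
Qed.
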